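(* Let $(\mathbb{N},d)$ be a uniformly locally finite metric space and let $E$ be a Banach space with a $1$-unconditional basis $\mathcal{E}$. Then $\mathrm{B}_u[d,\mathcal{E}]\subset\mathcal{L}(E)_r$, i.e., every band operator on $E$ (with respect to $d$ and $\mathcal{E}$) is regular.
   Context: All Banach spaces are complex unless said otherwise, and ''basis'' means Schauder basis. For a basis $\mathcal{E}=(e_n)_n$ of $E$, $(e_n^* )_n$ denotes the biorthogonal functionals and $\mathcal{L}(E)$ the bounded operators on $E$. Given a metric $d$ on $\mathbb{N}$, $a\in\mathcal{L}(E)$ is a band operator if there is $r>0$ such that $e_m^*(ae_n)=0$ whenever $d(n,m)>r$; $\mathrm{B}_u[d,\mathcal{E}]$ is the algebra of band operators. $d$ is uniformly locally finite if $\sup_{x}|B_r(x)|<\infty$ for all $r>0$ ($B_r(x)$ the closed $r$-ball). $\mathcal{E}$ is $1$-unconditional if $\|\sum_{n\le k}\alpha_ne_n\|\le\|\sum_{n\le k}\beta_ne_n\|$ for all $k$ and all scalars with $|\alpha_n|\le|\beta_n|$. Regular operators: let $E_{\mathbb{R}}$ be the closed real span of the $1$-unconditional basis $\mathcal{E}$, a real Banach lattice under the coordinatewise order; $E$ is its lattice complexification. For $a\in\mathcal{L}(E)$ write $a(x)=a_r(x)+ia_c(x)$ for $x\in E_{\mathbb{R}}$, with $a_r,a_c\in\mathcal{L}(E_{\mathbb{R}})$. The operator $a$ is regular if each of $a_r,a_c$ is a difference of two positive linear maps on $E_{\mathbb{R}}$, where a linear map is positive if it maps vectors with nonnegative coordinates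 to vectors with nonnegative coordinates. $\mathcal{L}(E)_r$ is the set of regular operators. *)

(* Defs.v *)
From mathcomp Require Import all_boot all_order all_algebra.
From mathcomp Require Import all_classical all_reals all_analysis.
From mathcomp Require Export complex.

Set Implicit Arguments.
Unset Strict Implicit.
Unset Printing Implicit Defensive.

Import Order.TTheory GRing.Theory Num.Theory.
Import numFieldNormedType.Exports.

Local Open Scope classical_set_scope.
Local Open Scope ring_scope.
Local Open Scope complex_scope.
Local Open Scope card_scope.

Section MetricOnNat.
Variables (R : realType) (d : nat -> nat -> R).

Definition is_metric : Prop :=
  [/\ forall x y, 0 <= d x y,
      forall x y, d x y = 0 <-> x = y,
      forall x y, d x y = d y x &
      forall x y z, d x z <= d x y + d y z].

Definition uniformly_locally_finite : Prop :=
  forall r : R, 0 < r ->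
    exists N : nat, forall x : nat, [set y | d x y <= r] #<= `I_N.

End MetricOnNat.

Section Basis.
Variables (R : realType) (E : completeNormedModType R[i]) (e : nat -> E).

Definition expansion (x : E) : set (nat -> R[i]) :=
  [set c | series (fun n => c n *: e n) @ \oo --> x].

Definition schauder_basis : Prop :=
  forall x : E, exists! c : nat -> R[i], expansion x c.

(* The biorthogonal functional [e_n^*]; it is meaningful when [e] is a Schauder
   basis, since only then is the chosen expansion of [x] the expansion of [x]. *)
Definition coord (n : nat) (x : E) : R[i] := xget (fun=> 0) (expansion x) n.

(* [`|_|] takes values in [R[i]], whose order is partial; an inequality between
   norms is the usual inequality between nonnegative real numbers. *)
Definition one_unconditional : Prop :=
  forall (k : nat) (alpha beta : nat -> R[i]),
    (forall n, (n < k)%N -> `|alpha n| <= `|beta n|) ->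
    `|\sum_(n < k) alpha n *: e n| <= `|\sum_(n < k) beta n *: e n|.

Definition bounded_operators : set {linear E -> E} :=
  [set a | continuous a].

Definition band_operators (d : nat -> nat -> R) : set {linear E -> E} :=
  [set a | bounded_operators a /\
     exists2 r : R, 0 < r &
       forall n m : nat, r < d n m -> coord m (a (e n)) = 0].

Definition real_span : set E :=
  closure [set x | exists (k : nat) (c : nat -> R),
                     x = \sum_(n < k) (c n)%:C *: e n].

(* Linear self-maps of the real Banach space [real_span] are represented by functions on [E] of which only
   the restriction to [real_span] is ever used. *)
Definition real_linear (f : E -> E) : Prop :=
  [/\ forall x, real_span x -> real_span (f x),
      forall x y, real_span x -> real_span y -> f (x + y) = f x + f y &
      forall (t : R) x, real_span x -> f (t%:C *: x) = t%:C *: f x].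

Definition real_bounded (f : E -> E) : Prop :=
  exists M : R, forall x, real_span x -> `|f x| <= M%:C * `|x|.

(* In [R[i]], [0 <= z] means that [z] is real and nonnegative. *)
Definition nonneg_coords (x : E) : Prop := forall n, 0 <= coord n x.

Definition positive_map (f : E -> E) : Prop :=
  real_linear f /\
  forall x, real_span x -> nonneg_coords x -> nonneg_coords (f x).

Definition difference_of_positive (f : E -> E) : Prop :=
  exists p q : E -> E,
    [/\ positive_map p, positive_map q &
        forall x, real_span x -> f x = p x - q x].

(* The coordinates of elements of [real_span] are real, so [ar] and [ac] are
   determined by [a] on [real_span]; the existential in [regular_operators]
   therefore involves no choice. *)
Definition real_components (a ar ac : E -> E) : Prop :=
  [/\ real_linear ar /\ real_bounded ar,
      real_linear ac /\ real_bounded ac &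
      forall x, real_span x -> a x = ar x + 'i *: ac x].

Definition regular_operators : set {linear E -> E} :=
  [set a | bounded_operators a /\
     exists ar ac : E -> E,
       [/\ real_components a ar ac,
           difference_of_positive ar & difference_of_positive ac]].

End Basis.

(* Main.v *)
(* Colour the points of [nat] with finitely many colours so that distinct points
   at distance at most [2r] get distinct colours, and let [P_j] be the coordinate
   projection onto the colour [j]; then [a] is the finite sum of the [a P_j]. If
   [a] has propagation [r], each row of [a P_j] has at most one nonzero entry.
   Replacing every entry [z] by [phi z], where [|phi z| <= |z|], thus amounts to
   composing [a P_j] on the left with a diagonal operator with entries of modulus
   at most [1], a contraction by 1-unconditionality. The positive and negative
   parts of the real and imaginary parts of the entries of [a] therefore all
   define bounded positive operators. *)
From Pilot Require Import Defs.
From HB Require Import structures.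
From mathcomp Require Import all_boot all_order all_algebra.
From mathcomp Require Import all_classical all_reals all_analysis.

Set Implicit Arguments.
Unset Strict Implicit.
Unset Printing Implicit Defensive.

Import Order.TTheory GRing.Theory Num.Theory.
Import numFieldNormedType.Exports.

Local Open Scope classical_set_scope.
Local Open Scope ring_scope.
Local Open Scope complex_scope.
Local Open Scope card_scope.

(** * Greedy colouring of locally finite graphs on [nat] *)

Section GreedyColouring.

Lemma exists_fresh (s : seq nat) : exists i, i \notin s.
Proof.
exists (\max_(j <- s) j).+1; apply/negP => /(@leq_bigmax_seq _ s xpredT id).
by move=> /(_ isT); rewrite ltnn.
Qed.

Definition fresh (s : seq nat) : nat := ex_minn (exists_fresh s).

Lemma fresh_notin s : fresh s \notin s.
Proof. by rewrite /fresh; case: ex_minnP. Qed.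

(** By minimality every number below [fresh s] occurs in [s], and these numbers are distinct. *)
Lemma fresh_le_size s : (fresh s <= size s)%N.
Proof.
rewrite /fresh; case: ex_minnP => m _ mmin; rewrite -[m in (m <= _)%N](size_iota 0).
apply: uniq_leq_size (iota_uniq _ _) _ => i; rewrite mem_iota add0n /= => im.
by apply: contraLR im => /mmin; rewrite -leqNgt.
Qed.

Variable adj : rel nat.

(** The colour of a vertex depends on those of all its earlier neighbours, so the recursion carries
    the whole list of colours. *)
Fixpoint greedy_colours (n : nat) : seq nat :=
  if n is m.+1 then
    let s := greedy_colours m in
    rcons s (fresh [seq nth 0%N s k | k <- iota 0 m & adj m k])
  else [::].

Definition greedy_colour (n : nat) : nat := nth 0%N (greedy_colours n.+1) n.

Lemma size_greedy_colours n : size (greedy_colours n) = n.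
Proof. by elim: n => //= n IH; rewrite size_rcons IH. Qed.

Lemma nth_greedy_colours n k : (k < n)%N ->
  nth 0%N (greedy_colours n) k = greedy_colour k.
Proof.
elim: n => // n IH; rewrite ltnS leq_eqVlt => /predU1P[-> //|kn].
by rewrite /= nth_rcons size_greedy_colours kn IH.
Qed.

Lemma greedy_colourE n : greedy_colour n =
  fresh [seq greedy_colour k | k <- iota 0 n & adj n k].
Proof.
rewrite {1}/greedy_colour /= nth_rcons size_greedy_colours ltnn eqxx.
congr fresh; apply/eq_in_map => k; rewrite mem_filter mem_iota add0n.
by case/andP => _ /= /nth_greedy_colours.
Qed.

Lemma greedy_colour_proper m n : symmetric adj -> m != n -> adj m n ->
  greedy_colour m != greedy_colour n.
Proof.
move=> adjC; wlog ltmn : m n / (m < n)%N => [hw|_ amn].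
  rewrite neq_ltn => /orP[lt|lt] amn; first by rewrite hw ?ltn_eqF.
  by rewrite eq_sym hw // ?ltn_eqF // adjC.
apply/eqP => E; have /negP := fresh_notin [seq greedy_colour k | k <- iota 0 n & adj n k].
rewrite -greedy_colourE -E; apply; apply: map_f.
by rewrite mem_filter mem_iota add0n /= ltmn adjC amn.
Qed.

(** The earlier neighbours of a vertex forbid at most [N] colours, so the least free one is at most
    [N]; this allows [N.+1] colours in all. *)
Lemma greedy_colour_le N : (forall n, [set k | adj n k] #<= `I_N) ->
  forall n, (greedy_colour n <= N)%N.
Proof.
move=> hN n; rewrite greedy_colourE (leq_trans (fresh_le_size _)) // size_map.
have fin : finite_set [set k | adj n k] by apply/finite_set_leP; exists N.
apply: leq_trans (geq_card_fset_set (hN n)).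
apply: uniq_leq_size => [|k]; first by rewrite filter_uniq // iota_uniq.
by rewrite mem_filter => /andP[ank _]; rewrite in_fset_set // inE.
Qed.

End GreedyColouring.

(** * The real numbers form a closed subset of the complex ones *)

Section ComplexScalars.
Context {R : realType}.
Implicit Types z w : R[i].

Lemma normc_ge_Im z : `|complex.Im z|%:C <= `|z|.
Proof.
by rewrite normc_def lecR -sqrtr_sqr ler_wsqrtr // lerDr sqr_ge0.
Qed.

Lemma approx_real z :
  (forall eps : R[i], 0 < eps -> exists2 w, w \is Num.real & `|z - w| <= eps) ->
  z \is Num.real.
Proof.
move=> zP; rewrite [z \is _](_ : _ = (complex.Im z == 0)); last first.
  by case: z {zP} => ? ?; rewrite complex_real.
(* The inequality is moved to [R[i]], so that the slack [eps] ranges over the same type as in the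
   hypothesis. *)
rewrite -normr_le0 -lecR; apply/ler_addgt0Pr => eps eps0; rewrite add0r.
have [_ /complex_realP[t ->]] := zP _ eps0.
apply: le_trans; have := normc_ge_Im (z - t%:C).
by case: z {zP} => a b; rewrite /= oppr0 addr0.
Qed.

End ComplexScalars.

(** * Coordinate functionals of a Schauder basis *)

Section UnconditionalBasis.
Context {R : realType} {E : completeNormedModType R[i]} {e : nat -> E}.
Hypothesis basis_e : schauder_basis e.
Implicit Types (x y : E) (c lam : nat -> R[i]).

Local Notation coord := (Pilot.Defs.coord e).

Lemma expansion_coord x : expansion e x (coord ^~ x).
Proof. by apply: xgetPex; have [c []] := basis_e x; exists c. Qed.

Arguments expansion_coord : clear implicits.

Lemma expansion_uniq x c : expansion e x c -> coord ^~ x = c.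
Proof.
move=> xc; have [c' [_ c'P]] := basis_e x.
by rewrite -(c'P _ xc) -(c'P _ (expansion_coord x)).
Qed.

Lemma coord_inj x y : (forall n, coord n x = coord n y) -> x = y.
Proof.
move=> xy; have := expansion_coord x; have := expansion_coord y.
have -> : coord ^~ x = coord ^~ y by apply/funext.
by rewrite /expansion /= => yc xc; apply: (norm_cvg_unique xc yc).
Qed.

Lemma coordD n x y : coord n (x + y) = coord n x + coord n y.
Proof.
suff /expansion_uniq /(congr1 (@^~ n)) : expansion e (x + y)
  (fun n => coord n x + coord n y) by [].
rewrite /expansion /=.
under eq_fun do rewrite scalerDl.
rewrite (_ : series _ =
    series (fun n => coord n x *: e n) + series (fun n => coord n y *: e n)).
  by apply: cvgD; apply: expansion_coord.
by apply/funext => k; rewrite fctE !seriesEord /= big_split.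
Qed.

Lemma coordZ n t x : coord n (t *: x) = t * coord n x.
Proof.
suff /expansion_uniq /(congr1 (@^~ n)) : expansion e (t *: x)
  (fun n => t * coord n x) by [].
rewrite /expansion /=.
under eq_fun do rewrite -scalerA.
rewrite (_ : series _ = t \*: series (fun n => coord n x *: e n)).
  by apply: cvgZl_tmp; apply: expansion_coord.
by apply/funext => k; rewrite /= !seriesEord /= scaler_sumr.
Qed.

HB.instance Definition _ n := GRing.isLinear.Build R[i] E R[i] *%R (coord n)
  (fun t x y => etrans (coordD n _ y) (congr1 (+%R^~ _) (coordZ n t x))).

Lemma coord_basis n m : coord n (e m) = (n == m)%:R.
Proof.
suff /expansion_uniq /(congr1 (@^~ n)) : expansion e (e m) (fun n => (n == m)%:R) by [].
apply/cvgrPdist_lt => eps eps0; near=> k.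
have mk : (m < k)%N by near: k; exists m.+1.
rewrite seriesEord /= (bigD1 (Ordinal mk)) //= eqxx scale1r big1 ?addr0 ?subrr ?normr0 //.
by move=> i /negPf; rewrite -val_eqE /= => ->; rewrite scale0r.
Unshelve. all: by end_near.
Qed.

Lemma basis_neq0 n : e n != 0.
Proof.
apply/eqP => en0; have := coord_basis n n; rewrite en0 linear0 eqxx => /eqP.
by rewrite eq_sym oner_eq0.
Qed.

(** * Diagonal multipliers along a 1-unconditional basis *)

Hypothesis uncond_e : one_unconditional e.

Lemma scaler_if0 (V : lmodType R[i]) (b : bool) (t : R[i]) (v : V) :
  (if b then t else 0) *: v = if b then t *: v else 0.
Proof. by case: b; rewrite ?scale0r. Qed.

(** Setting the coefficients below [k] to zero on both sides preserves domination. Blocks of this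
    kind are what the Cauchy criterion for series controls. *)
Lemma uncond_interval (alpha beta : nat -> R[i]) k l :
  (forall n, `|alpha n| <= `|beta n|) ->
  `|\sum_(k <= n < l) alpha n *: e n| <= `|\sum_(k <= n < l) beta n *: e n|.
Proof.
move=> ab; rewrite !big_geq_mkord big_mkcond [X in _ <= `|X|]big_mkcond /=.
have /= := @uncond_e l (fun n => if (k <= n)%N then alpha n else 0)
  (fun n => if (k <= n)%N then beta n else 0).
under eq_bigr do rewrite scaler_if0.
under [X in _ <= `|X|]eq_bigr do rewrite scaler_if0.
by apply=> n _; case: ifP.
Qed.

Lemma partial_sum_le x k : `|series (fun n => coord n x *: e n) k| <= `|x|.
Proof.
apply/ler_addgt0Pr => eps eps0.
(* The index [maxn N k] is late enough for the partial sum to be within [eps] of [x], and long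
   enough to dominate the [k]-th one. *)
have /cvgrPdist_lt /(_ _ eps0) [N _ /(_ (maxn N k))] := expansion_coord x.
rewrite /= leq_maxl distrC => /(_ isT) xN.
have /le_trans : `|series (fun n => coord n x *: e n) k| <=
    `|series (fun n => coord n x *: e n) (maxn N k)|; last first.
  apply; rewrite -[X in `|X|](subrK x) addrC (le_trans (ler_normD _ _)) // lerD2l.
  exact: ltW.
rewrite /series /= !big_mkord.
rewrite (big_ord_widen _ (fun n => coord n x *: e n) (leq_maxr N k)) big_mkcond /=.
under eq_bigr do rewrite -scaler_if0.
apply: (@uncond_e _ (fun n => if (n < k)%N then coord n x else 0) (coord ^~ x)) => n _.
by case: ifP => // _; rewrite normr0.
Qed.

(** The diagonal operator with entries [lam n]; the limit is known to exist once [lam] is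
    contractive. *)
Definition multiplier lam x : E :=
  lim (series (fun n => (lam n * coord n x) *: e n) @ \oo).

Definition contractive lam : Prop := forall n, `|lam n| <= 1.

Lemma expansion_multiplier lam (lam1 : contractive lam) x :
  expansion e (multiplier lam x) (fun n => lam n * coord n x).
Proof.
apply/cauchy_cvgP/cauchy_seriesP => eps eps0.
have := cvgP _ (expansion_coord x) => /cauchy_cvgP/cauchy_seriesP/(_ _ eps0).
apply: filterS => -[k l] /=; apply: le_lt_trans; apply: uncond_interval => n.
by rewrite normrM ler_piMl.
Qed.

Arguments expansion_multiplier {lam} lam1 x.

Lemma coord_multiplier lam x n : contractive lam ->
  coord n (multiplier lam x) = lam n * coord n x.
Proof.
move=> lam1.
by have /(congr1 (@^~ n)) := expansion_uniq (expansion_multiplier lam1 x).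
Qed.

Lemma multiplier_le lam x : contractive lam -> `|multiplier lam x| <= `|x|.
Proof.
move=> lam1; apply/ler_addgt0Pr => eps eps0.
have /cvgrPdist_lt /(_ _ eps0) [N _ /(_ N (leqnn _))] := expansion_multiplier lam1 x.
move=> /ltW xN;
rewrite -[X in `|X|](subrK (series (fun n => (lam n * coord n x) *: e n) N)).
rewrite (le_trans (ler_normD _ _)) // addrC lerD //.
apply: le_trans (partial_sum_le x N); apply: uncond_interval => n.
by rewrite normrM ler_piMl.
Qed.

(** The rank-one projection onto [e n] is the multiplier by the indicator of [n], hence a
    contraction. This makes the coordinate functionals continuous. *)
Lemma coord_le x n : `|coord n x| * `|e n| <= `|x|.
Proof.
have d1 : contractive (fun m => (m == n)%:R).
  by move=> m; case: eqP => _; rewrite ?normr1 ?normr0.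
apply: le_trans (multiplier_le x d1); rewrite -normrZ.
rewrite (_ : multiplier _ _ = coord n x *: e n) //; apply: coord_inj => m.
rewrite coord_multiplier // linearZ /= coord_basis.
by case: eqP => [->|_]; rewrite ?mulr1 ?mul1r ?mul0r ?mulr0.
Qed.

(** Realness of coordinates passes to limits because coordinates are continuous; conversely, the
    partial sums of an expansion with real coordinates are real combinations tending to [x]. *)
Lemma real_spanP x : real_span e x <-> forall n, coord n x \is Num.real.
Proof.
split=> [xspan n|xreal B].
  have en0 : 0 < `|e n| by rewrite normr_gt0 basis_neq0.
  apply: approx_real => eps eps0.
  have [y [[k [c ->]]]] := xspan _ (nbhsx_ballx x _ (mulr_gt0 eps0 en0)).
  rewrite -ball_normE /= => /ltW xy.
  exists (coord n (\sum_(i < k) (c i)%:C *: e i)).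
    rewrite linear_sum rpred_sum // => i _; rewrite linearZ /= coord_basis rpredM //.
      by apply/complex_realP; exists (c i).
    by rewrite realn.
  by rewrite -linearB -(ler_pM2r en0) (le_trans (coord_le _ _)).
move=> /(expansion_coord x) [N _ /(_ N (leqnn _)) BN].
exists (series (fun n => coord n x *: e n) N); split => //.
exists N, (fun n => complex.Re (coord n x)); rewrite seriesEord /=.
by apply: eq_bigr => i _; rewrite RRe_real.
Qed.

Lemma coord_lim_const m (u : nat -> E) x t : u @ \oo --> x ->
  (\forall k \near \oo, coord m (u k) = t) -> coord m x = t.
Proof.
move=> ux ut; apply/eqP; rewrite -subr_eq0 -normr_le0; apply/ler_addgt0Pr => eps eps0.
have em0 : 0 < `|e m| by rewrite normr_gt0 basis_neq0.
move/cvgrPdist_lt : ux => /(_ _ (mulr_gt0 eps0 em0)) ux.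
have [N _ /(_ N (leqnn _)) [/ltW xuN <-]] := filterI ux ut.
by rewrite add0r -linearB -(ler_pM2r em0) (le_trans (coord_le _ _)).
Qed.

(** * Operators whose matrix rows have boundedly many nonzero entries *)

Definition indic (S : pred nat) : nat -> R[i] := fun n => (S n)%:R.

Lemma contractive_indic S : contractive (indic S).
Proof. by move=> n; rewrite /indic; case: (S n); rewrite ?normr1 ?normr0. Qed.

(** Applied to partial sums of the restriction of [x] to [S], the [m]-th coordinate of [a] is
    constant once column [g] is included; continuity carries this value to the limit. *)
Lemma coord_column (a : {linear E -> E}) (S : pred nat) m g x : continuous a ->
  (forall n, S n -> n != g -> coord m (a (e n)) = 0) ->
  coord m (a (multiplier (indic S) x)) = indic S g * coord m (a (e g)) * coord g x.
Proof.
move=> ca aS0.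
apply: (coord_lim_const (u := a \o series (fun n => (indic S n * coord n x) *: e n))).
  apply: continuous_cvg; first exact: ca.
  exact: expansion_multiplier (contractive_indic S) x.
near=> k.
have gk : (g < k)%N by near: k; exists g.+1.
rewrite /= seriesEord /= !linear_sum (bigD1 (Ordinal gk)) //= big1 ?addr0.
  by rewrite !linearZ /= mulrAC.
move=> i; rewrite -val_eqE /= => ig; rewrite !linearZ /= /indic.
by case: (boolP (S i)) => Si; [rewrite aS0 // mulr0|rewrite !mul0r].
Unshelve. all: by end_near.
Qed.

Lemma linear_bound (a : {linear E -> E}) : continuous a ->
  exists2 M : R, 0 <= M & forall x, `|a x| <= M%:C * `|x|.
Proof.
move=> /linear_bounded_continuous/linear_boundedP[M [Mreal MP]].
have M1 : `|M| + 1 \is Num.real by rewrite realD ?normr_real ?real1.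
exists (complex.Re (`|M| + 1)); last first.
  by move=> x; rewrite RRe_real // MP // (le_lt_trans (real_ler_norm Mreal)) // ltrDl.
by rewrite -lecR RRe_real // addr_ge0.
Qed.

(** A sparse matrix: row [m] has entry [w j m] in column [g j m], so each coordinate of [f x] is a
    finite sum. *)
Definition row_form (I : finType) (w : I -> nat -> R[i]) (g : I -> nat -> nat)
  (f : E -> E) : Prop := forall m x, coord m (f x) = \sum_j w j m * coord (g j m) x.

(* In row [m], [w j m] is the only entry of [a] of colour [j], in column [g j m]
   ([w j m = 0] when there is none). *)
Lemma entrywise_calculus (a : {linear E -> E}) (colour : nat -> nat) (N : nat) :
  continuous a -> (forall n, (colour n <= N)%N) ->
  (forall m n n', coord m (a (e n)) != 0 -> coord m (a (e n')) != 0 ->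
     colour n = colour n' -> n = n') ->
  exists (w : 'I_N.+1 -> nat -> R[i]) (g : 'I_N.+1 -> nat -> nat),
    row_form w g a /\
    forall phi : R[i] -> R[i], (forall z, `|phi z| <= `|z|) ->
      exists2 f : E -> E, row_form (fun j m => phi (w j m)) g f &
        exists M : R, forall x, `|f x| <= M%:C * `|x|.
Proof.
move=> ca colourN colour_inj.
pose S (j : 'I_N.+1) : pred nat := fun n => colour n == j.
have gP j m : exists g, forall n, S j n -> n != g -> coord m (a (e n)) = 0.
  have [[g /andP[Sg ag]]|no] := pselect (exists g, S j g && (coord m (a (e g)) != 0)).
    exists g => n /eqP Sn; apply: contra_neq_eq => an.
    by apply: colour_inj an ag _; rewrite Sn (eqP Sg).
  (* Row [m] has no nonzero entry of colour [j], so any column serves. *)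
  exists 0%N => n Sn _; apply/eqP; apply: contra_notT no => an.
  by exists n; rewrite Sn.
pose g j m := xget 0%N [set g | forall n, S j n -> n != g -> coord m (a (e n)) = 0].
pose w j m := indic (S j) (g j m) * coord m (a (e (g j m))).
have wP j m x : coord m (a (multiplier (indic (S j)) x)) = w j m * coord (g j m) x.
  by apply: coord_column => //; apply: (xgetPex 0%N (gP j m)).
exists w, g; split=> [m x|phi phi_le].
  under eq_bigr do rewrite -wP.
  (* The colour classes partition [nat], so the projections onto them add up to the identity. *)
  rewrite -!linear_sum; congr (coord m (a _)); apply: coord_inj => n.
  rewrite linear_sum /= (bigD1 (Ordinal (colourN n : (colour n < N.+1)%N))) //= big1.
    by rewrite coord_multiplier ?addr0;
      [rewrite /indic /S eqxx mul1r|exact: contractive_indic].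
  move=> j; rewrite -val_eqE eq_sym /= => /negPf jn.
  by rewrite coord_multiplier; [rewrite /indic /S jn mul0r|exact: contractive_indic].
(* Left multiplication by [lam j] turns each entry [w j m] into [phi (w j m)]. Where [w j m] is zero
   the quotient is zero, which agrees with [phi 0 = 0]. *)
pose lam j m := phi (w j m) / w j m.
have phi0 : phi 0 = 0 by apply/eqP; rewrite -normr_le0 (le_trans (phi_le 0)) ?normr0.
have lam1 j : contractive (lam j).
  move=> m; rewrite /lam; have [->|w0] := eqVneq (w j m) 0.
    by rewrite phi0 mul0r normr0.
  by rewrite normf_div ler_pdivrMr ?normr_gt0 // mul1r.
exists (fun x => \sum_j multiplier (lam j) (a (multiplier (indic (S j)) x))) => [m x|].
  rewrite linear_sum; apply: eq_bigr => j _ /=.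
  rewrite coord_multiplier // wP /lam mulrA; congr (_ * _).
  by have [->|w0] := eqVneq (w j m) 0; [rewrite phi0 !mul0r|rewrite divfK].
have [M M0 aM] := linear_bound ca.
(* Each of the [N.+1] colours contributes at most [M] times the norm of [x], since both multipliers
   are contractions. *)
exists (M *+ N.+1) => x; rewrite (le_trans (ler_norm_sum _ _ _)) //.
rewrite raddfMn mulrnAl -[N.+1 in X in _ <= X]card_ord -sumr_const ler_sum // => j _.
rewrite (le_trans (multiplier_le _ (lam1 j))) // (le_trans (aM _)) //.
rewrite ler_wpM2l ?ler0c // multiplier_le //; exact: contractive_indic.
Qed.

Lemma row_form_positive (I : finType) (w : I -> nat -> R[i]) (g : I -> nat -> nat) f :
  (forall j m, 0 <= w j m) -> row_form w g f -> positive_map e f.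
Proof.
move=> w0 fE; split; first split=> [x /real_spanP xreal|x y _ _|t x _].
- apply/real_spanP => m; rewrite fE rpred_sum // => j _.
  by rewrite rpredM // ger0_real.
- apply: coord_inj => m; rewrite linearD /= !fE -big_split /=.
  by apply: eq_bigr => j _; rewrite linearD /= mulrDr.
- apply: coord_inj => m; rewrite linearZ /= !fE mulr_sumr.
  by apply: eq_bigr => j _; rewrite linearZ /= mulrCA.
- by move=> x _ x0 m; rewrite fE sumr_ge0 // => j _; rewrite mulr_ge0.
Qed.

Lemma real_linear_difference f h : real_linear e f -> real_linear e h ->
  real_linear e (fun x => f x - h x).
Proof.
move=> [fr fD fZ] [hr hD hZ]; split=> [x xr|x y xr yr|t x xr].
- apply/real_spanP => n; rewrite linearB /= rpredB //.
    by move: n; apply/real_spanP/fr.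
  by move: n; apply/real_spanP/hr.
- by rewrite fD // hD // opprD addrACA.
- by rewrite fZ // hZ // scalerBr.
Qed.

Lemma regular_of_entrywise (a : {linear E -> E}) (I : finType)
    (w : I -> nat -> R[i]) (g : I -> nat -> nat) :
  continuous a -> row_form w g a ->
  (forall phi : R[i] -> R[i], (forall z, `|phi z| <= `|z|) ->
     exists2 f : E -> E, row_form (fun j m => phi (w j m)) g f &
       exists M : R, forall x, `|f x| <= M%:C * `|x|) ->
  regular_operators e a.
Proof.
move=> ca aE calc.
pose pos (s : R) : R[i] := (Num.max s 0)%:C.
have pos_ge0 s : 0 <= pos s by rewrite ler0c le_max lexx orbT.
have pos_le s : `|pos s| <= `|s|%:C.
  by rewrite ger0_norm // lecR ge_max ler_norm normr_ge0.
have posB s : pos s - pos (- s) = s%:C.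
  rewrite -rmorphB /=; congr (_%:C); have [s0|s0] := leP 0 s.
    by rewrite max_r ?subr0 // oppr_le0.
  by rewrite max_l ?sub0r ?opprK // oppr_ge0 ltW.
(* To be used with [h] the real and the imaginary part: the positive and negative parts of [h] of
   the entries give the two positive maps, and [f] is their difference. *)
have part (h : R[i] -> R) : (forall z, `|h z|%:C <= `|z|) ->
    exists f : E -> E, [/\ row_form (fun j m => (h (w j m))%:C) g f,
      real_linear e f /\ real_bounded e f & difference_of_positive e f].
  move=> hle.
  have [|p pE [Mp Mple]] := calc (fun z => pos (h z)).
    by move=> z; apply: le_trans (hle z).
  have [|q qE [Mq Mqle]] := calc (fun z => pos (- h z)).
    by move=> z; apply: le_trans (pos_le _) _; rewrite normrN.
  have p0 := row_form_positive (fun j m => pos_ge0 (h (w j m))) pE.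
  have q0 := row_form_positive (fun j m => pos_ge0 (- h (w j m))) qE.
  exists (fun x => p x - q x); split; [|split|by exists p, q].
  - move=> m x; rewrite linearB /= pE qE -sumrB.
    by apply: eq_bigr => j _; rewrite -mulrBl posB.
  - by apply: real_linear_difference; [case: p0|case: q0].
  - exists (Mp + Mq) => x _; rewrite (le_trans (ler_normB _ _)) //.
    by rewrite raddfD mulrDl lerD.
have [ar [arE arb arP]] := part _ (@normc_ge_Re R).
have [ac [acE acb acP]] := part _ (@normc_ge_Im R).
split=> //; exists ar, ac; split=> //; split=> // x _.
apply: coord_inj => m; rewrite linearD linearZ /= aE arE acE mulr_sumr -big_split /=.
by apply: eq_bigr => j _; rewrite mulrA -mulrDl -complexE.
Qed.

End UnconditionalBasis.

(** * Colouring the metric space, and the theorem *)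

Lemma exists_sparse_colouring (R : realType) (d : nat -> nat -> R) (r : R) :
  is_metric d -> uniformly_locally_finite d -> 0 < r ->
  exists (N : nat) (colour : nat -> nat), (forall n, (colour n <= N)%N) /\
    forall m n n', d n m <= r -> d n' m <= r -> colour n = colour n' -> n = n'.
Proof.
move=> [d0 dE dC dT] dlf r0.
have [N dN] := dlf (r + r) (addr_gt0 r0 r0).
(* Two points within [r] of the same [m] are within [r + r] of each other, so distinct ones are
   adjacent. *)
pose adj : rel nat := fun m n => d m n <= r + r.
exists N, (greedy_colour adj); split; first exact: greedy_colour_le.
move=> m n n' nm n'm; apply: contra_eq => nn'; apply: greedy_colour_proper => //.
  by move=> x y; rewrite /adj dC.
by rewrite /adj (le_trans (dT _ m _)) // lerD // dC.
Qed.

Theorem proposition4p2 (R : realType) (d : nat -> nat -> R)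
    (E : completeNormedModType R[i]%C) (e : nat -> E) :
  is_metric d -> uniformly_locally_finite d ->
  schauder_basis e -> one_unconditional e ->
  band_operators e d `<=` regular_operators e.
Proof.
move=> dmet dlf basis_e uncond_e a [ca [r r0 band]].
have [N [colour [colourN colour_inj]]] := exists_sparse_colouring dmet dlf r0.
(* The nonzero entries of row [m] lie in columns within [r] of [m], where the colouring is
   injective. *)
have close m n : Defs.coord e m (a (e n)) != 0 -> d n m <= r.
  by apply: contra_neqT; rewrite -ltNge => /band.
have [|w [g [aE calc]]] := entrywise_calculus basis_e uncond_e ca colourN.
  by move=> m n n' /close nm /close n'm; apply: colour_inj nm n'm.
exact: regular_of_entrywise aE calc.
Qed.
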